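(* Let $n \ge 2$ be an integer. Let $T$ be any tree with $n+1$ vertices $V_1,\dots,V_{n+1}$, with edges oriented so as to give an oriented tree $\overrightarrow{T}$ with positively oriented edges $\overrightarrow{E_1},\dots,\overrightarrow{E_n}$. Let $f$ be a continuous vertex map on $T$. Let $\mathcal{R}$ be the field of real numbers, $\mathcal{Z}_2$ the field of two elements, and $\mathcal{F}$ a field with unity $1$. Let $\overrightarrow{W_{\mathcal F}}^n$, $\overrightarrow{W_{\mathcal Z_2}}^n$, $\Phi_f$, $\mathcal{A}_n(f)$ and $\mathcal{B}_n(f)$ be as defined in the context. Then the following hold. (1) For each integer $1 \le i \le n$, $\sum_{k=0}^n \Phi_f^k(\overrightarrow{E_i}) = \mathbf{0}$, and so $\sum_{k=0}^n \Phi_f^k(w) = \mathbf{0}$ for all $w$ in $\overrightarrow{W_{\mathcal F}}^n$. (2) Let $i$ and $j$ be two integers in the interval $[1,n]$ and let $\overrightarrow{J}$ denote the shortest path $\overrightarrow{[V_i, f^j(V_i)]}$ in $\overrightarrow{T}$. If $j$ and $n+1$ are relatively prime, then the set $\mathcal{W}_f = \{\Phi_f^k(\overrightarrow{J}) : 0 \le k \le n-1\}$ is a basis for $\overrightarrow{W_{\mathcal Z_2}}^n$, and is a basis for $\overrightarrow{W_{\mathcal F}}^n$ when $\mathcal{F}$ is a field with characteristic zero or when the determinant of the matrix $\mathcal{M}_f$ of the set $\mathcal{W}_f$ with respect to the basis $\mathcal{E} = \{\overrightarrow{E_1},\dots,\overrightarrow{E_n}\}$ is not divisible by the finite characteristic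 of $\mathcal{F}$. Furthermore, when $T$ is a tree in the real line with $n+1$ vertices and $f$ is a continuous vertex map on $T$, then the constant term of the characteristic polynomial of the matrix $\mathcal{M}_f$ is $\pm 1$, and hence the set $\mathcal{W}_f$ is a basis of $\overrightarrow{W_{\mathcal F}}^n$ for any field $\mathcal{F}$ (however, not all coefficients of the characteristic polynomial of the matrix $\mathcal{M}_f$ are odd integers: see, for example, the six-vertex example described at the end of the context, with $\overrightarrow{J} = \overrightarrow{[1,2]}$, where the corresponding characteristic polynomial is $x^5-x^4-x+1$). (3) Over any field $\mathcal{F}$ with characteristic zero ($\mathcal{Z}_2$ respectively), the oriented transition matrix $\mathcal{A}_n(f)$ and its inverse $[\mathcal{A}_n(f)]^{-1}$, as $\{-1,0,1\}$-matrices, are similar to the following companion matrix $$ \begin{bmatrix} 0 & 1 & 0 & 0 & \cdots & 0 \\ 0 & 0 & 1 & 0 & \cdots & 0 \\ 0 & 0 & 0 & 1 & \cdots & 0 \\ & \vdots & & & \vdots & \\ -1 & -1 & -1 & -1 & \cdots & -1 \end{bmatrix} $$ of the polynomial $\sum_{k=0}^n x^k$ through invertible $\{-1,0,1\}$-matrices over $\mathcal{F}$ ($\mathcal{Z}_2$ respectively) and have the same characteristic polynomial $\sum_{k=0}^n x^k$, while the unoriented transition matrices of all continuous vertex maps on $T$ may not be similar to each other over the same field $\mathcal{F}$ ($\mathcal{Z}_2$ respectively). Furthermore, if $T$ is a tree in the real line, then the oriented transition matrices, when considered over any field, of all continuous vertex maps on $T$ with $n+1$ vertices and their inverses are similar to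 one another through invertible $\{-1,0,1\}$-matrices and have the same characteristic polynomial $\sum_{k=0}^n x^k$. (4) The coefficients of the characteristic polynomial of the unoriented transition matrix $\mathcal{B}_n(f)$, when considered as a matrix over $\mathcal{R}$, are all odd integers. Furthermore, the unoriented transition matrices over any field of all continuous vertex maps on all trees with $n+1$ vertices, when considered as matrices over $\mathcal{Z}_2$, are similar to one another and have characteristic polynomial $\sum_{k=0}^n x^k$, but may not be similar to each other when considered over the finite field $\mathcal{Z}_p = \{0,1,2,\dots,p-1\}$, where $p \ge 3$ is a prime number.
   Context: A tree $T$ with $n+1$ vertices $V_1,\dots,V_{n+1}$ and $n$ edges $E_1,\dots,E_n$ is regarded as a topological space (each edge being an arc joining its two end vertices). An oriented tree $\overrightarrow{T}$ is $T$ with a choice of orientation for each edge; the positively oriented edges are $\overrightarrow{E_1},\dots,\overrightarrow{E_n}$, where $\overrightarrow{E_i} = \overrightarrow{[V_{i_1},V_{i_2}]}$ goes from its first vertex $V_{i_1}$ to its second vertex $V_{i_2}$, and $-\overrightarrow{E_i}$ denotes the same edge with opposite orientation. For two vertices $V, V'$, $\overrightarrow{[V,V']}$ denotes the unique shortest path from $V$ to $V'$, a sequence of oriented edges from $\{\pm\overrightarrow{E_s}: 1\le s\le n\}$, each starting where the previous one ends. ''Tree in the real line'' means a compact interval subdivided by $n+1$ vertices (two of them the endpoints), the edges being the intervals between consecutive vertices. A continuous vertex map on $T$ is a continuous map $f: T \to T$ such that the $n+1$ vertices of $T$ form a periodic orbit of $f$ (so $f$ permutes the $n+1$ vertices cyclically),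 and for each edge with end vertices $V_{i_1}, V_{i_2}$, as $x$ moves monotonically from $V_{i_1}$ to $V_{i_2}$ along the edge, $f(x)$ moves monotonically from $f(V_{i_1})$ to $f(V_{i_2})$ along the shortest path $\overrightarrow{[f(V_{i_1}), f(V_{i_2})]}$. The oriented transition matrix $\mathcal{A}_n(f) = (\alpha_{i,j})$ is the $n \times n$ matrix over the field $\mathcal{F}$ with, for $\overrightarrow{E_i} = \overrightarrow{[V_{i_1},V_{i_2}]}$: $\alpha_{i,j} = 1$ if $\overrightarrow{E_j}$ appears in the shortest path $\overrightarrow{[f(V_{i_1}), f(V_{i_2})]}$, $\alpha_{i,j} = -1$ if $-\overrightarrow{E_j}$ appears in it, and $\alpha_{i,j} = 0$ otherwise. The unoriented transition matrix $\mathcal{B}_n(f) = (\beta_{i,j})$ over $\mathcal{F}$ has $\beta_{i,j} = 1$ if $\overrightarrow{E_j}$ or $-\overrightarrow{E_j}$ appears in that path (equivalently $f(E_i) \supset E_j$) and $\beta_{i,j} = 0$ otherwise. $\overrightarrow{W_{\mathcal F}}^n$ is the $n$-dimensional $\mathcal{F}$-vector space with basis $\mathcal{E} = \{\overrightarrow{E_1},\dots,\overrightarrow{E_n}\}$ ($\overrightarrow{W_{\mathcal Z_2}}^n$ is the case $\mathcal F=\mathcal Z_2$); $-\overrightarrow{E_j}$ is identified with the additive inverse of $\overrightarrow{E_j}$. A shortest path $\overrightarrow{[V,V']} = \overrightarrow{e_1}\cdots\overrightarrow{e_m}$ is also regarded as the vector $\sum_{k=1}^m \overrightarrow{e_k}$.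 $\Phi_f$ is the linear map of $\overrightarrow{W_{\mathcal F}}^n$ into itself with $\Phi_f(\overrightarrow{E_i}) = \sum_{j=1}^n \alpha_{i,j}\overrightarrow{E_j}$ for $1 \le i \le n$; $\Phi_f^k$ is its $k$-th iterate, with $\Phi_f^0$ the identity. The matrix $\mathcal{M}_f$ of $\mathcal{W}_f$ with respect to $\mathcal{E}$ is the $n\times n$ $\{-1,0,1\}$-matrix whose rows are, in order, the coordinates of $\overrightarrow{J}, \Phi_f(\overrightarrow{J}), \dots, \Phi_f^{n-1}(\overrightarrow{J})$ with respect to $\overrightarrow{E_1},\dots,\overrightarrow{E_n}$; in the divisibility condition and in the statements about its characteristic polynomial it is viewed as an integer matrix. For $n\times n$ matrices $M_1, M_2$ over $\mathcal{F}$, $M_1$ is said to be similar to $M_2$ through the invertible matrix $G$ if $M_1 G = G M_2$. A $\{-1,0,1\}$-matrix is a matrix all of whose entries lie in $\{-1,0,1\}$. Example referred to in (2): $n=5$, the tree with vertices $1,\dots,6$ and positively oriented edges $\overrightarrow{E_1}=\overrightarrow{[1,2]}$, $\overrightarrow{E_2}=\overrightarrow{[3,2]}$, $\overrightarrow{E_3}=\overrightarrow{[2,5]}$, $\overrightarrow{E_4}=\overrightarrow{[5,6]}$, $\overrightarrow{E_5}=\overrightarrow{[5,4]}$, and a continuous vertex map $f$ with $1\mapsto 2\mapsto 3\mapsto 4\mapsto 5\mapsto 6\mapsto 1$. Its oriented transition matrix is $$ \begin{bmatrix} 0 & -1 & 0 & 0 & 0 \\ 0 & -1 & -1 & 0 &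 -1 \\ 0 & 1 & 1 & 1 & 0 \\ -1 & 0 & -1 & -1 & 0 \\ 0 & 0 & 0 & -1 & 0 \end{bmatrix}. $$
   Formalization: In (3), the claim that unoriented transition matrices may not be similar is stated only for fields of characteristic zero; its ''(Z_2 respectively)'' part is dropped, since over Z_2 unoriented and oriented matrices coincide and are all similar, as (4) itself asserts. *)

(* Defs.v *)
(* Mathematical Components / MathComp-Analysis. *)
From HB Require Import structures.
From mathcomp Require Export all_boot all_order all_algebra.
From mathcomp Require Export all_classical all_reals all_analysis.

Set Implicit Arguments.
Unset Strict Implicit.
Unset Printing Implicit Defensive.

Export Order.TTheory GRing.Theory Num.Theory.
Export numFieldNormedType.Exports.

Local Open Scope classical_set_scope.
Local Open Scope ring_scope.

(* The pair (i, true) is the positively oriented edge E_i and (i, false) is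
   the oppositely oriented edge - E_i. *)
Definition dart (n : nat) : Type := ('I_n * bool)%type.

Section Walks.
Variables (n : nat) (src tgt : 'I_n -> 'I_n.+1).

Definition dart_src (e : dart n) := if e.2 then src e.1 else tgt e.1.
Definition dart_tgt (e : dart n) := if e.2 then tgt e.1 else src e.1.

Fixpoint is_walk (u : 'I_n.+1) (p : seq (dart n)) (v : 'I_n.+1) : bool :=
  if p is e :: q then (dart_src e == u) && is_walk (dart_tgt e) q v else u == v.
End Walks.

(* Vertices V_1, ..., V_{n+1} and edges E_1, ..., E_n are indexed from 0.
   A cycle is a nonempty closed walk running over pairwise distinct edges, so
   [otree_acyclic] also excludes loops and multiple edges. *)
Record otree (n : nat) := OTree {
  esrc : 'I_n -> 'I_n.+1;
  etgt : 'I_n -> 'I_n.+1;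
  otree_connected : forall u v, exists p, is_walk esrc etgt u p v;
  otree_acyclic : forall u p,
    is_walk esrc etgt u p u -> uniq [seq e.1 | e <- p] -> p = [::]
}.

Section ShortestPath.
Variables (n : nat) (T : otree n).

Definition walk := is_walk (esrc T) (etgt T).

Definition is_shortest_path (u v : 'I_n.+1) (p : seq (dart n)) : Prop :=
  walk u p v /\ forall q, walk u q v -> (size p <= size q)%N.

Definition spath (u v : 'I_n.+1) : seq (dart n) :=
  xget [::] [set p | is_shortest_path u v p].
End ShortestPath.

(* An oriented tree realised as a topological space, namely the subset
   [tset T] of a Hausdorff space S (possibly S itself) with the induced
   topology; E_i is the arc parametrised by [arc i] on [0, 1], from its first
   to its second vertex. *)
Record ttree (R : realType) (n : nat) (S : topologicalType) := TTree {
  otree_of :> otree n;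
  vertex : 'I_n.+1 -> S;
  arc : 'I_n -> R -> S;
  ttree_hausdorff : hausdorff_space S;
  vertex_inj : injective vertex;
  arc_continuous : forall i, {within `[0, 1], continuous (arc i)};
  arc_inj : forall i, {in `[0, 1] &, injective (arc i)};
  arc_src : forall i, arc i 0 = vertex (esrc otree_of i);
  arc_tgt : forall i, arc i 1 = vertex (etgt otree_of i);
  arc_vertex : forall i t v,
    t \in `[0, 1] -> arc i t = vertex v -> t = 0 \/ t = 1;
  arc_meet : forall i j s t, i != j -> s \in `[0, 1] -> t \in `[0, 1] ->
    arc i s = arc j t -> exists v, arc i s = vertex v
}.

Section VertexMaps.
Variables (R : realType) (n : nat) (S : topologicalType) (T : ttree R n S).

Definition edge_set (i : 'I_n) : set S := arc T i @` `[0, 1].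

Definition tset : set S := \bigcup_i edge_set i.

Definition dart_point (e : dart n) (s : R) : S :=
  if e.2 then arc T e.1 s else arc T e.1 (1 - s).

Definition periodic_orbit (f : S -> S) (O : set S) : Prop :=
  exists2 x, (exists2 m, (0 < m)%N & iter m f x = x)
           & O = [set iter k f x | k in [set: nat]].

(* The index of x among the vertices; meaningful only if x is a vertex. *)
Definition vidx (x : S) : 'I_n.+1 := xget ord0 [set v | vertex T v = x].

(* The path [f(V_{i_1}), f(V_{i_2})], where E_i = [V_{i_1}, V_{i_2}]. *)
Definition image_path (f : S -> S) (i : 'I_n) : seq (dart n) :=
  spath T (vidx (f (vertex T (esrc T i)))) (vidx (f (vertex T (etgt T i)))).

(* [phi t] is the length travelled by f along the image path of E_i (each edge
   having length 1) when x has reached the point of parameter t of E_i;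
   "monotonically" is taken in the weak sense. *)
Definition monotone_on_edge (f : S -> S) (i : 'I_n) : Prop :=
  let p := image_path f i in
  exists phi : R -> R,
    [/\ {in `[0, 1] &, {homo phi : s t / s <= t}},
        phi 0 = 0, phi 1 = (size p)%:R &
        forall (t : R) (k : nat), t \in `[0, 1] -> (k < size p)%N ->
          k%:R <= phi t <= k.+1%:R ->
          f (arc T i t) = dart_point (nth (i, true) p k) (phi t - k%:R)].

(* Only the restriction of f to [tset] matters. *)
Definition continuous_vertex_map (f : S -> S) : Prop :=
  [/\ f @` tset `<=` tset, {within tset, continuous f},
      periodic_orbit f (range (vertex T)) &
      forall i, monotone_on_edge f i].
End VertexMaps.

Definition in_real_line (R : realType) (n : nat) (T : ttree R n R) : Prop :=
  exists a b : R,
    [/\ a < b, tset T = `[a, b]%classic,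
        exists u, vertex T u = a, exists v, vertex T v = b &
        forall i, let x := vertex T (esrc T i) in let y := vertex T (etgt T i) in
          edge_set T i = `[Num.min x y, Num.max x y]%classic /\
          forall v, ~ (Num.min x y < vertex T v < Num.max x y)].

Section Matrices.
Variables (R : realType) (n : nat) (S : topologicalType) (T : ttree R n S).
Variables (K : nzRingType) (f : S -> S).

Definition oriented_mx : 'M[K]_n :=
  \matrix_(i < n, j < n)
    if (j, true) \in image_path T f i then 1
    else if (j, false) \in image_path T f i then -1 else 0.

Definition unoriented_mx : 'M[K]_n :=
  \matrix_(i < n, j < n)
    if ((j, true) \in image_path T f i) || ((j, false) \in image_path T f i)
    then 1 else 0.

(* W_K^n is 'rV[K]_n; its basis vector E_i is the i-th unit row vector, hence
   Phi_f (E_i) = \sum_j alpha_(i, j) E_j is the i-th row of the oriented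
   transition matrix. *)
Definition edge_vec (i : 'I_n) : 'rV[K]_n := delta_mx 0 i.

Definition path_vec (p : seq (dart n)) : 'rV[K]_n :=
  \sum_(e <- p) (if e.2 then edge_vec e.1 else - edge_vec e.1).

Definition Phi (w : 'rV[K]_n) : 'rV[K]_n := w *m oriented_mx.

Definition Jvec (i : 'I_n.+1) (j : nat) : 'rV[K]_n :=
  path_vec (spath T i (vidx T (iter j f (vertex T i)))).

Definition Wf (i : 'I_n.+1) (j : nat) : seq 'rV[K]_n :=
  [seq iter k Phi (Jvec i j) | k <- iota 0 n].

(* The paths J, f(J), f^2(J), ... have coordinates -1, 0, 1 computed by the same
   formulas over every ring; M_f as an integer matrix is the case K = int. *)
Definition Mf (i : 'I_n.+1) (j : nat) : 'M[K]_n :=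
  \matrix_(k < n) iter k Phi (Jvec i j).
End Matrices.

Arguments oriented_mx {R n S} T K f.
Arguments unoriented_mx {R n S} T K f.
Arguments edge_vec {n} K i.
Arguments Phi {R n S} T K f w.
Arguments Jvec {R n S} T K f i j.
Arguments Wf {R n S} T K f i j.
Arguments Mf {R n S} T K f i j.

Definition is_basis (F : fieldType) (n : nat) (X : seq 'rV[F]_n) : bool :=
  basis_of {: 'rV[F]_n} X.

Definition char_zero (F : fieldType) : Prop := [pchar F] =i pred0.

Definition odd_int (z : int) : bool := ~~ (2 %| z)%Z.

Definition pm1_mx (K : nzRingType) (n : nat) (A : 'M[K]_n) : Prop :=
  forall i j, A i j \in [:: -1; 0; 1].

Definition similar_through (F : fieldType) (n : nat) (G A B : 'M[F]_n) : Prop :=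
  G \in unitmx /\ A *m G = G *m B.

Definition similar_mx (F : fieldType) (n : nat) (A B : 'M[F]_n) : Prop :=
  exists G, similar_through G A B.

Definition pm1_similar (F : fieldType) (n : nat) (A B : 'M[F]_n) : Prop :=
  exists2 G, pm1_mx G & similar_through G A B.

Definition geom_poly (F : fieldType) (n : nat) : {poly F} :=
  \sum_(0 <= k < n.+1) 'X^k.

(* The companion matrix of [geom_poly F n]. *)
Definition geom_companion (F : fieldType) (n : nat) : 'M[F]_n :=
  \matrix_(i < n, j < n)
    if i == n.-1 :> nat then -1 else (i.+1 == j :> nat)%:R.

(* The six-vertex oriented tree with edges [1,2], [3,2], [2,5], [5,6], [5,4]
   (vertex k has index k - 1), the map 1 -> 2 -> ... -> 6 -> 1, and its
   oriented transition matrix. *)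
Definition six_tree (T : otree 5) : Prop :=
  [seq nat_of_ord (esrc T i) | i <- enum 'I_5] = [:: 0; 2; 1; 4; 4]%N /\
  [seq nat_of_ord (etgt T i) | i <- enum 'I_5] = [:: 1; 1; 4; 5; 3]%N.

Definition six_map (R : realType) (S : topologicalType) (T : ttree R 5 S)
    (f : S -> S) : Prop :=
  continuous_vertex_map T f /\ forall v, f (vertex T v) = vertex T (ordS v).

Definition six_mx : 'M[int]_5 :=
  \matrix_(i < 5, j < 5)
    (nth [::] [:: [::  0; -1;  0;  0;  0 ];
                  [::  0; -1; -1;  0; -1 ];
                  [::  0;  1;  1;  1;  0 ];
                  [:: -1;  0; -1; -1;  0 ];
                  [::  0;  0;  0; -1;  0 ]] i)`_j.

(* Main.v *)
(* Write [V, V'] for the vector of the shortest path.  It only depends on the end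
   points of a walk, since a closed walk has vector 0, whence
   [U, V] + [V, W] = [U, W], and Phi_f [U, V] = [f U, f V].  Everything about
   the oriented matrix is therefore read off the cyclic permutation f of the
   vertices:
   - sum_k Phi_f^k [U, V] = 0, because both ends run through all the vertices;
   - for j prime to n + 1 the segments [V, f^j V] join up into a cycle through
     all the vertices, so that all but one of them span the whole module over
     any ring: M_f is always unimodular;
   - for j = 1 the inverse of M_f has rows (indicator of an interval), up to
     sign, so it is a {-1,0,1}-matrix conjugating A_n(f) to the companion matrix;
   - a bijection s of the vertices with s f = g s induces a {-1,0,1}-matrix
     conjugating A_n(f) to A_n(g).
   As B_n(f) is the entrywise square of A_n(f), the two agree modulo 2.
   For the examples, a tree is realised in R^n by sending V to [V_1, V]: edges
   become unit segments parallel to the axes, and a vertex map extends to a sum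
   of functions of one coordinate each. *)
Require Import Defs.
From mathcomp Require Import zify ring lra.

Set Implicit Arguments.
Unset Strict Implicit.
Unset Printing Implicit Defensive.

Local Open Scope classical_set_scope.
Local Open Scope ring_scope.

(** * Walks and their vectors *)

Lemma walk_catP n (src tgt : 'I_n -> 'I_n.+1) u p q v :
  is_walk src tgt u (p ++ q) v <->
  exists2 w, is_walk src tgt u p w & is_walk src tgt w q v.
Proof.
split; elim: p u => [|e p IHp] u /=.
- by exists u.
- by move=> /andP[-> /IHp[w pw qw]]; exists w.
- by case=> w /eqP->.
- by case=> w /andP[-> pw] qw; apply: IHp; exists w.
Qed.

Section WalkVectors.
Variables (n : nat) (T : otree n) (K : nzRingType).
Implicit Types (u v w : 'I_n.+1) (p q : seq (dart n)) (e : dart n).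

Definition dart_vec e : 'rV[K]_n := if e.2 then edge_vec K e.1 else - edge_vec K e.1.

Lemma path_vec_nil : path_vec K ([::] : seq (dart n)) = 0.
Proof. by rewrite /path_vec big_nil. Qed.

Lemma path_vec_cons e p : path_vec K (e :: p) = dart_vec e + path_vec K p.
Proof. by rewrite /path_vec big_cons. Qed.

Lemma path_vec_cat p q : path_vec K (p ++ q) = path_vec K p + path_vec K q.
Proof. by rewrite /path_vec big_cat. Qed.

Lemma repeated_edgeP p : ~~ uniq [seq e.1 | e <- p] ->
  exists p1 e p2 e' p3, p = p1 ++ e :: p2 ++ e' :: p3 /\ e'.1 = e.1.
Proof.
elim: p => // e p IHp /=; rewrite negb_and negbK => /orP[/mapP[e' e'p ee']|/IHp].
  by case/splitPr: e'p => p2 p3; exists [::], e, p2, e', p3.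
by move=> [p1 [e1 [p2 [e2 [p3 [-> ?]]]]]]; exists (e :: p1), e1, p2, e2, p3.
Qed.

(** Cut the walk at two passages of one edge. In equal directions, the part from the first passage
    up to the second is closed; in opposite directions, the part between them is closed and the two
    passages are dropped, as their vectors cancel. *)
Lemma repeated_edge_walk u v p : walk T u p v -> ~~ uniq [seq e.1 | e <- p] ->
  exists w q r, [/\ walk T u q v, walk T w r w, (size q < size p)%N,
    (size r < size p)%N & path_vec K p = path_vec K q + path_vec K r].
Proof.
move=> pw /repeated_edgeP[p1 [e [p2 [e' [p3 [pE ee']]]]]].
move: pw; rewrite pE => /walk_catP[w1 w1P].
rewrite -cat_cons => /walk_catP[w2]; rewrite /walk /= => /andP[/eqP s1 w2P].
case/andP=> /eqP s2 w3P; have [ee2|ee2] := eqVneq e.2 e'.2.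
  have Ee : e' = e by case: (e) (e') ee' ee2 => a b [c d] /= -> ->.
  exists w1, (p1 ++ e' :: p3), (e :: p2); split.
  - by apply/walk_catP; exists w1 => //; rewrite /walk /= Ee s1 eqxx -Ee.
  - by move: w2P; rewrite -s2 Ee s1 /walk /= s1 eqxx.
  - by rewrite /= !size_cat /= size_cat /=; lia.
  - by rewrite /= !size_cat /= size_cat /=; lia.
  rewrite Ee !(path_vec_cat, path_vec_cons) -!addrA; congr (_ + _).
  by rewrite addrA addrC -addrA.
have Ee : dart_src (esrc T) (etgt T) e' = dart_tgt (esrc T) (etgt T) e.
  by rewrite /dart_src /dart_tgt ee'; case: (e.2) (e'.2) ee2 => [] [].
have Et : dart_tgt (esrc T) (etgt T) e' = dart_src (esrc T) (etgt T) e.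
  by rewrite /dart_src /dart_tgt ee'; case: (e.2) (e'.2) ee2 => [] [].
have Ev : dart_vec e' = - dart_vec e.
  by rewrite /dart_vec ee'; case: (e.2) (e'.2) ee2 => [] [] // _; rewrite opprK.
exists w2, (p1 ++ p3), p2; split.
- by apply/walk_catP; exists w1 => //; rewrite -s1 -Et.
- by rewrite -{1}s2 Ee.
- by rewrite /= !size_cat /= size_cat /=; lia.
- by rewrite /= !size_cat /= size_cat /=; lia.
rewrite !(path_vec_cat, path_vec_cons) Ev -!addrA.
congr (_ + _); rewrite addrCA [RHS]addrC; congr (_ + _).
by rewrite addrA subrr add0r.
Qed.

(** Induction on the length: without a repeated edge acyclicity makes the walk empty, otherwise it
    splits into two shorter closed walks. *)
Lemma closed_walk_vec u p : walk T u p u -> path_vec K p = 0.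
Proof.
have [m] := ubnP (size p); elim: m u p => // m IHm u p pm pw.
have [pu|/(repeated_edge_walk pw)] := boolP (uniq [seq e.1 | e <- p]).
  by rewrite (otree_acyclic pw pu) path_vec_nil.
case=> w [q [r [qw rw qp rp ->]]].
by rewrite (IHm u q _ qw) ?(IHm w r _ rw) ?addr0 //; lia.
Qed.

Lemma walk_vec_eq u v p q :
  walk T u p v -> walk T u q v -> path_vec K p = path_vec K q.
Proof.
move=> pw qw; have [r rw] := otree_connected T v u.
apply: (@addIr _ (path_vec K r)); rewrite -!path_vec_cat.
by rewrite !(@closed_walk_vec u) //; apply/walk_catP; exists v.
Qed.

(** Descent on the length yields a shortest walk, so [xget] never falls back on its default
    [[::]]. *)
Lemma spathP u v : is_shortest_path T u v (spath T u v).
Proof.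
rewrite /spath; case: xgetP => [p _ //|no].
have [p pw] := otree_connected T u v.
suff [q qP] : exists q, is_shortest_path T u v q by case: (no q).
have [m] := ubnP (size p); elim: m p pw => // m IHm p pw pm.
have [pP|/existsNP[q /not_implyP[qw /negP]]] :=
  pselect (forall q, walk T u q v -> (size p <= size q)%N).
  by exists p.
by rewrite -ltnNge => qp; apply: (IHm q) => //; apply: leq_trans qp _.
Qed.

Lemma spath_walk u v : walk T u (spath T u v) v.
Proof. by case: (spathP u v). Qed.

Lemma spath_uniq u v : uniq [seq e.1 | e <- spath T u v].
Proof.
have [pw pmin] := spathP u v; apply/negPn/negP => /(repeated_edge_walk pw).
by case=> w [q [r [/pmin + _ + _ _]]]; rewrite leqNgt => /negP.
Qed.

Lemma path_vec_coef p j : uniq [seq e.1 | e <- p] ->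
  path_vec K p 0 j =
    if (j, true) \in p then 1 else if (j, false) \in p then -1 else 0.
Proof.
elim: p => [|[i b] p IHp] /=; first by rewrite path_vec_nil mxE.
case/andP=> ip /IHp {}IHp; rewrite path_vec_cons mxE IHp !inE !xpair_eqE.
have [ji|ji] := eqVneq j i; last first.
  by rewrite /dart_vec; case: b => /=; rewrite !mxE (negPf ji) ?oppr0 add0r.
have nip c : (j, c) \in p = false.
  by apply: contraNF ip => jp; apply/mapP; exists (j, c).
by rewrite !nip /dart_vec; case: b; rewrite /= !mxE ji !eqxx addr0.
Qed.

Definition pathc u v : 'rV[K]_n := path_vec K (spath T u v).

Lemma pathc_walk u v p : walk T u p v -> path_vec K p = pathc u v.
Proof. by move=> pw; apply: walk_vec_eq pw (spath_walk u v). Qed.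

Lemma pathcD u v w : pathc u v + pathc v w = pathc u w.
Proof.
rewrite -path_vec_cat; apply: pathc_walk.
by apply/walk_catP; exists v; apply: spath_walk.
Qed.

Lemma pathcc u : pathc u u = 0.
Proof. exact: closed_walk_vec (spath_walk u u). Qed.

Lemma pathcB u v w : pathc u w - pathc u v = pathc v w.
Proof. by rewrite -(pathcD u v w) [pathc u v + _]addrC addrK. Qed.

Lemma pathcN u v : - pathc u v = pathc v u.
Proof. by rewrite -(pathcB u v u) pathcc add0r. Qed.

Lemma pathc_dart e :
  pathc (dart_src (esrc T) (etgt T) e) (dart_tgt (esrc T) (etgt T) e) = dart_vec e.
Proof.
rewrite -(@pathc_walk _ _ [:: e]); last by rewrite /walk /= !eqxx.
by rewrite path_vec_cons path_vec_nil addr0.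
Qed.

Lemma pathc_edge i : pathc (esrc T i) (etgt T i) = edge_vec K i.
Proof. exact: (pathc_dart (i, true)). Qed.

Lemma pathc_coef u v j : pathc u v 0 j =
  if (j, true) \in spath T u v then 1
  else if (j, false) \in spath T u v then -1 else 0.
Proof. exact/path_vec_coef/spath_uniq. Qed.

Lemma pathc_pm1 u v j : pathc u v 0 j \in [:: -1; 0; 1].
Proof. by rewrite pathc_coef; do 2?case: ifP => _; rewrite !inE eqxx ?orbT. Qed.

Lemma pathc_eq0 u v : pathc u v = 0 -> u = v.
Proof.
move=> uv0; have := spath_walk u v; case: (spath T u v) (pathc_coef u v) => [|e p].
  by move=> _ /eqP.
move=> /(_ e.1) + _; rewrite uv0 mxE; case: e => i [] /=; rewrite !inE !eqxx //=.
  by move/eqP; rewrite eq_sym oner_eq0.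
by case: ifP => _ /eqP; rewrite eq_sym ?oppr_eq0 oner_eq0.
Qed.

(** Meant for [D] the difference of two functions of a vertex: equal increments along the edges and
    equality at one vertex give equality everywhere. *)
Lemma edge_constant (V : Type) (D : 'I_n.+1 -> V) :
  (forall i, D (esrc T i) = D (etgt T i)) -> forall u v, D u = D v.
Proof.
move=> De u v; have [p] := otree_connected T u v.
elim: p u => [|e p IHp] u /=; first by move/eqP->.
case/andP=> /eqP <- /IHp <-; rewrite /dart_src /dart_tgt.
by case: e.2; rewrite De.
Qed.

End WalkVectors.

(** * Cyclic permutations *)

Section CyclicMaps.
Variable n : nat.
Implicit Types (th s : 'I_n.+1 -> 'I_n.+1) (u v x : 'I_n.+1).

Definition cyclic_map th := injective th /\ forall u v, fconnect th u v.

Lemma cyclic_of_orbit th x m : (0 < m)%N -> iter m th x = x ->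
  (forall v, exists k, v = iter k th x) -> cyclic_map th.
Proof.
move=> m0 mx reach; have inj : injective th.
  (* On the orbit of [x] the iterate [m.-1] undoes [th]. *)
  apply: (can_inj (g := iter m.-1 th)) => v; rewrite -iterSr prednK //.
  by have [k ->] := reach v; rewrite -iterD addnC iterD mx.
split=> // u v; have [k ->] := reach v; have [l ->] := reach u.
by rewrite (connect_trans _ (fconnect_iter _ _ _)) // fconnect_sym // fconnect_iter.
Qed.

Lemma cyclic_order th x : cyclic_map th -> order th x = n.+1.
Proof.
case=> _ thc; rewrite /order -[RHS]card_ord; apply: eq_card => v.
exact: thc.
Qed.

Lemma cyclic_iter_order th x : cyclic_map th -> iter n.+1 th x = x.
Proof. by move=> thc; have := iter_order thc.1 x; rewrite cyclic_order. Qed.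

Lemma cyclic_reindex th x : cyclic_map th ->
  bijective (fun k : 'I_n.+1 => iter k th x).
Proof.
move=> thc; apply: injF_bij => k l kl; apply: ord_inj.
by rewrite -[LHS](@findex_iter _ th x k) ?cyclic_order // kl findex_iter ?cyclic_order.
Qed.

Lemma cyclic_sum th x (V : zmodType) (g : 'I_n.+1 -> V) : cyclic_map th ->
  \sum_(0 <= k < n.+1) g (iter k th x) = \sum_u g u.
Proof.
move=> thc; rewrite big_mkord.
by rewrite [RHS](reindex _ (onW_bij _ (cyclic_reindex x thc))).
Qed.

Lemma cyclic_iterM th k u : iter n.+1 th u = u -> iter (k * n.+1) th u = u.
Proof. by move=> thu; elim: k => // k IHk; rewrite mulSn iterD IHk. Qed.

Lemma cyclic_iter th j : cyclic_map th -> coprime j n.+1 ->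
  cyclic_map (iter j th).
Proof.
move=> thc jn; split.
  by case: thc => thi _; elim: j {jn} => //= j IHj; apply: inj_comp.
move=> u v; have [_ /(_ u v) uv] := thc.
have iterM m : iter m (iter j th) u = iter (m * j) th u.
  by elim: m => // m IHm; rewrite mulSn iterD -IHm.
rewrite -(iter_findex uv); set d := findex _ _ _.
have [j0|j_gt0] := posnP j.
  move: jn; rewrite j0 /coprime gcd0n => /eqP n1.
  suff -> : iter d th u = u by rewrite connect0.
  by apply: ord_inj; move: (ltn_ord (iter d th u)) (ltn_ord u); lia.
(* Bezout: [k * j = l * n.+1 + 1], so [k] steps of [iter j th] amount to one step of [th]. *)
have [k l kl _] := egcdnP n.+1 j_gt0.
rewrite (_ : iter d th u = iter (d * k) (iter j th) u) ?fconnect_iter //.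
rewrite iterM -mulnA kl (eqP jn) mulnDr muln1 iterD.
by rewrite mulnA cyclic_iterM // cyclic_iter_order.
Qed.

(** Each map shifts the positions in its orbit of [ord0], so [s] matches equal positions of the two
    orbits. *)
Lemma cyclic_conj th th' : cyclic_map th -> cyclic_map th' ->
  exists s, bijective s /\ forall u, s (th u) = th' (s u).
Proof.
move=> thc thc'; have [a ka ak] := cyclic_reindex ord0 thc.
have [b kb bk] := cyclic_reindex ord0 thc'.
pose s u := iter (a u) th' ord0; exists s; split.
  exists (fun u => iter (b u) th ord0) => u; rewrite /s.
    by rewrite (kb (a u)) ak.
  by rewrite (ka (b u)) bk.
move=> u; rewrite -[RHS]iterS -[X in th X](ak u) -iterS /s.
have := ltn_ord (a u); rewrite ltnS leq_eqVlt => /orP[/eqP an|an].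
  (* At the last position both orbits return to [ord0]. *)
  by rewrite an !cyclic_iter_order // (ka ord0).
by rewrite (ka (Ordinal (an : ((a u).+1 < n.+1)%N))).
Qed.

Lemma cyclic_inv th : cyclic_map th ->
  exists th', [/\ cyclic_map th', cancel th th' & cancel th' th].
Proof.
move=> thc; have [thi tht] := thc; exists (finv th); split.
- by split=> [|u v]; [exact: finv_inj | rewrite same_fconnect_finv].
- exact: finv_f.
- exact: f_finv.
Qed.
End CyclicMaps.

(** * Transition matrices *)

Section TransitionMatrix.
Variables (n : nat) (T : otree n).
Implicit Types (th s : 'I_n.+1 -> 'I_n.+1) (u v x : 'I_n.+1) (K : nzRingType).

(** Defined for an arbitrary map of the vertices, so that inverses, iterates and conjugating
    bijections have matrices too. *)
Definition tmx K th : 'M[K]_n :=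
  \matrix_(i < n) pathc T K (th (esrc T i)) (th (etgt T i)).

Lemma edge_vec_mul K m i (A : 'M[K]_(n, m)) : edge_vec K i *m A = row i A.
Proof. by rewrite rowE. Qed.

Lemma dart_vec_tmx K th e : dart_vec K e *m tmx K th =
  pathc T K (th (dart_src (esrc T) (etgt T) e)) (th (dart_tgt (esrc T) (etgt T) e)).
Proof.
rewrite /dart_vec /dart_src /dart_tgt; case: e.2.
  by rewrite edge_vec_mul rowK.
by rewrite mulNmx edge_vec_mul rowK pathcN.
Qed.

Lemma pathc_tmx K th u v : pathc T K u v *m tmx K th = pathc T K (th u) (th v).
Proof.
rewrite {1}/pathc; move: (spath T u v) (spath_walk T u v) => p.
elim: p u => [|e p IHp] u.
  by rewrite /walk /= path_vec_nil mul0mx => /eqP ->; rewrite pathcc.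
rewrite /walk /= => /andP[/eqP <- /IHp pv].
by rewrite path_vec_cons mulmxDl dart_vec_tmx pv pathcD.
Qed.

Lemma tmx_mul K th th' : tmx K th *m tmx K th' = tmx K (th' \o th).
Proof. by apply/row_matrixP => i; rewrite row_mul !rowK pathc_tmx. Qed.

Lemma tmx_id K : tmx K id = 1%:M.
Proof. by apply/row_matrixP => i; rewrite rowK pathc_edge rowE mulmx1. Qed.

Lemma tmx_pm1 K th : pm1_mx (tmx K th).
Proof. by move=> i j; rewrite mxE pathc_pm1. Qed.

Lemma tmx_unit (K : comUnitRingType) th : bijective th -> tmx K th \in unitmx.
Proof.
case=> th' thK th'K; suff /mulmx1_unit[] : tmx K th *m tmx K th' = 1%:M by [].
by rewrite tmx_mul (_ : th' \o th = id) ?tmx_id //; apply/funext => u /=.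
Qed.

Lemma invmx_tmx (K : comUnitRingType) th th' : cancel th th' -> cancel th' th ->
  invmx (tmx K th) = tmx K th'.
Proof.
move=> thK th'K; have thu : tmx K th \in unitmx by apply: tmx_unit; exists th'.
apply: (can_inj (mulKmx thu)); rewrite mulmxV // tmx_mul.
by rewrite (_ : th' \o th = id) ?tmx_id //; apply/funext => u /=.
Qed.

Lemma iter_tmx K th k u v :
  iter k (fun w => w *m tmx K th) (pathc T K u v) =
  pathc T K (iter k th u) (iter k th v).
Proof. by elim: k => //= k ->; rewrite pathc_tmx. Qed.

Lemma sum_iter_pathc K th u v : cyclic_map th ->
  \sum_(0 <= k < n.+1) pathc T K (iter k th u) (iter k th v) = 0.
Proof.
(* Both ends are measured from the fixed vertex [u]. *)
move=> thc; under eq_bigr do rewrite -(pathcB _ _ u).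
by rewrite sumrB !(cyclic_sum _ (pathc T K u)) // subrr.
Qed.

Lemma sum_iter_tmx K th (w : 'rV[K]_n) : cyclic_map th ->
  \sum_(0 <= k < n.+1) iter k (fun y => y *m tmx K th) w = 0.
Proof.
move=> thc; have iterE k : iter k (fun y => y *m tmx K th) w = w *m tmx K (iter k th).
  elim: k => [|k /= ->]; first by rewrite tmx_id mulmx1.
  by rewrite -mulmxA tmx_mul.
under eq_bigr do rewrite iterE.
rewrite -mulmx_sumr (_ : \sum_(0 <= k < n.+1) _ = 0) ?mulmx0 //.
apply/row_matrixP => i; rewrite row0 raddf_sum /=.
by under eq_bigr do rewrite rowK; apply: sum_iter_pathc.
Qed.

Definition orbit_mx K th u v : 'M[K]_n :=
  \matrix_(k < n) pathc T K (iter k th u) (iter k th v).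

Lemma orbit_mx_linv (K : comUnitRingType) th j x : cyclic_map th -> coprime j n.+1 ->
  exists N, N *m orbit_mx K th x (iter j th x) = 1%:M.
Proof.
move=> thc jn; set M := orbit_mx _ _ _ _.
(* The path vectors in the row module of [M]. The relation is transitive, so it suffices to join
   vertices by chains of segments. *)
pose P u v := exists r : 'rV_n, r *m M = pathc T K u v.
have Pcat u v w : P u v -> P v w -> P u w.
  by case=> r1 r1E [r2 r2E]; exists (r1 + r2); rewrite mulmxDl r1E r2E pathcD.
have itC k : iter k th (iter j th x) = iter j th (iter k th x).
  by rewrite -!iterD addnC.
have Pk (k : 'I_n) : P (iter k th x) (iter j th (iter k th x)).
  by exists (delta_mx 0 k); rewrite -rowE rowK itC.
(* The segment starting at [iter n th x] is not a row; as all n + 1 segments sum to zero, it is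
   minus the sum of the rows. *)
have Pn : P (iter n th x) (iter j th (iter n th x)).
  exists (- const_mx 1); have := sum_iter_pathc K x (iter j th x) thc.
  rewrite big_nat_recr //= itC => /eqP; rewrite addrC addr_eq0 => /eqP->.
  rewrite mulNmx; congr (- _); rewrite big_mkord.
  rewrite mulmx_sum_row; apply: eq_bigr => k _.
  by rewrite mxE scale1r rowK.
have Pj v : P v (iter j th v).
  have [k _ kK] := cyclic_reindex x thc; rewrite -(kK v).
  have := ltn_ord (k v); rewrite ltnS leq_eqVlt => /orP[/eqP->//|kn].
  exact: (Pk (Ordinal kn)).
(* The map [iter j th] is itself cyclic, so its steps lead from any vertex to any other. *)
have PT u v : P u v.
  have [_ /(_ u v)/iter_findex <-] := cyclic_iter thc jn.
  elim: (findex _ _ _) => [|m IHm]; first by exists 0; rewrite mul0mx pathcc.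
  exact: Pcat IHm (Pj _).
have /fin_all_exists[r rE] i := PT (esrc T i) (etgt T i).
exists (\matrix_i r i); apply/row_matrixP => i.
by rewrite row_mul rowK rE pathc_edge rowE mulmx1.
Qed.

Lemma orbit_mx_unit (K : comUnitRingType) th j x : cyclic_map th -> coprime j n.+1 ->
  orbit_mx K th x (iter j th x) \in unitmx.
Proof. by move=> thc /(orbit_mx_linv K x thc)[N /mulmx1_unit[]]. Qed.

(** For [m] at most n, the coordinates of the path from [x] to [iter m th x] in the rows of
    [orbit_mx K th x (th x)]. *)
Definition initial_vec K m : 'rV[K]_n := \row_k (k < m)%:R.

(** Row [i] writes E_i as the difference of two paths from [x]. Initial segments are nested, so the
    row is, up to sign, the indicator of an interval. *)
Definition orbit_inv_mx K th x : 'M[K]_n :=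
  \matrix_i (initial_vec K (findex th x (etgt T i)) -
             initial_vec K (findex th x (esrc T i))).

Lemma orbit_inv_mx_pm1 K th x : pm1_mx (orbit_inv_mx K th x).
Proof.
move=> i j; rewrite !mxE; case: (_ < _)%N; case: (_ < _)%N; rewrite !inE;
by rewrite ?subrr ?sub0r ?subr0 eqxx ?orbT.
Qed.

(** The first [m] segments of the orbit of [x] telescope. *)
Lemma initial_vec_orbit K th x m : (m <= n)%N ->
  initial_vec K m *m orbit_mx K th x (th x) = pathc T K x (iter m th x).
Proof.
move=> mn; rewrite mulmx_sum_row.
rewrite (eq_bigr (fun k : 'I_n => if (k < m)%N then
  pathc T K (iter k th x) (iter k.+1 th x) else 0)); last first.
  by move=> k _; rewrite mxE rowK -iterSr; case: ifP; rewrite ?scale1r ?scale0r.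
rewrite -big_mkcond -(big_ord_widen _ (fun k => pathc T K (iter k th x) (iter k.+1 th x)) mn).
elim: m {mn} => [|m IHm]; first by rewrite big_ord0 pathcc.
by rewrite big_ord_recr /= IHm pathcD.
Qed.

Lemma orbit_inv_mxK (K : comUnitRingType) th x : cyclic_map th ->
  orbit_inv_mx K th x *m orbit_mx K th x (th x) = 1%:M.
Proof.
move=> thc; have [_ tht] := thc.
have fP v : (findex th x v <= n)%N.
  by have := findex_max (tht x v); rewrite cyclic_order.
apply/row_matrixP => i; rewrite row_mul rowK mulmxBl !initial_vec_orbit //.
by rewrite !iter_findex // pathcB pathc_edge rowE mulmx1.
Qed.

End TransitionMatrix.

(** * The companion matrix of 1 + x + ... + x^n *)

Section Companion.
Variables (n : nat) (F : fieldType).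

Lemma size_geom_poly : size (geom_poly F n) = n.+1.
Proof.
rewrite /geom_poly; elim: n => [|m IHm].
  by rewrite big_nat1 expr0 size_poly1.
by rewrite big_nat_recr //= addrC size_polyDl size_polyXn // IHm.
Qed.

Lemma coef_geom_poly k : (k <= n)%N -> (geom_poly F n)`_k = 1.
Proof.
move=> kn; rewrite /geom_poly big_mkord coef_sum.
rewrite (bigD1 (Ordinal (kn : (k < n.+1)%N))) //= coefXn eqxx.
rewrite big1 ?addr0 // => i /negPf ik; rewrite coefXn eq_sym.
by rewrite -[k]/(nat_of_ord (Ordinal (kn : (k < n.+1)%N))) (inj_eq val_inj) ik.
Qed.

Lemma char_poly_companion : char_poly (geom_companion F n) = geom_poly F n.
Proof.
have pm : geom_poly F n \is monic.
  by rewrite monicE /lead_coef size_geom_poly coef_geom_poly.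
rewrite -[RHS](companionmxK pm).
(* [companionmx p] has dimension [(size p).-1], which equals [n] only up to this equation; hence the
   cast. *)
have sE : (size (geom_poly F n)).-1 = n by rewrite size_geom_poly.
have castE m m' (e : m = m') (A : 'M[F]_m) :
    char_poly (castmx (e, e) A) = char_poly A by case: _ / e.
rewrite -(castE _ _ sE); congr char_poly.
apply/matrixP => i j; rewrite castmxE !mxE /= size_geom_poly.
by rewrite coef_geom_poly // -ltnS ltnW // ltnS ltn_ord.
Qed.

Lemma char_poly_similar (A B G : 'M[F]_n) : G \in unitmx ->
  A *m G = G *m B -> char_poly A = char_poly B.
Proof.
move=> Gu AG; rewrite /char_poly /char_poly_mx.
pose Gp := map_mx polyC G.
have Gpu : \det Gp != 0 by rewrite det_map_mx polyC_eq0 -unitfE -unitmxE.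
apply: (mulIf Gpu); rewrite -det_mulmx [RHS]mulrC -det_mulmx; congr (\det _).
by rewrite mulmxBl mulmxBr -!map_mxM AG mul_scalar_mx mul_mx_scalar.
Qed.

End Companion.

(** * Similarity to the companion matrix and between transition matrices *)

Section Similarity.
Variables (n : nat) (T : otree n).

(** The rows of [M] are successive images of one vector, so the companion matrix on its left and the
    transition matrix on its right both shift them by one. The inverse [G] of [M] then
    conjugates. *)
Lemma tmx_companion (F : fieldType) th : cyclic_map th ->
  pm1_similar (tmx T F th) (geom_companion F n).
Proof.
move=> thc; pose M := orbit_mx T F th ord0 (th ord0).
pose G := orbit_inv_mx T F th ord0.
have GM : G *m M = 1%:M by apply: orbit_inv_mxK.
have [Gu _] := mulmx1_unit GM; have MG := mulmx1C GM.
have CM : geom_companion F n *m M = M *m tmx T F th.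
  apply/row_matrixP => k; rewrite !row_mul rowK pathc_tmx -!iterS mulmx_sum_row.
  (* The image of the last row is not a row of [M]; the vanishing sum of the n + 1 images gives it
     as minus the sum of the rows. *)
  have [kn|kn] := eqVneq (k : nat) n.-1.
    have nE : k.+1 = n by rewrite kn prednK // (leq_ltn_trans _ (ltn_ord k)).
    have := sum_iter_pathc T F ord0 (th ord0) thc.
    rewrite big_nat_recr //= addrC -!iterS => /eqP; rewrite addr_eq0 nE => /eqP ->.
    rewrite big_mkord -sumrN; apply: eq_bigr => i _.
    by rewrite !mxE kn eqxx rowK scaleN1r.
  have kn' : (k.+1 < n)%N by have := ltn_ord k; lia.
  rewrite (bigD1 (Ordinal kn')) //= big1 => [|i /negPf ik].
    by rewrite addr0 !mxE (negPf kn) eqxx scale1r rowK.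
  rewrite !mxE (negPf kn) (_ : (k.+1 == i) = false) ?scale0r //.
  by rewrite eq_sym; apply: contraFF ik => /eqP ik; apply/eqP/ord_inj.
exists G; first exact: orbit_inv_mx_pm1.
(* Multiply [CM] by [G] on both sides. *)
split=> //; rewrite -[LHS]mul1mx -GM -!mulmxA [M *m _]mulmxA -CM.
by rewrite -mulmxA MG mulmx1.
Qed.


Lemma tmx_pm1_similar (F : fieldType) th th' :
  cyclic_map th -> cyclic_map th' -> pm1_similar (tmx T F th) (tmx T F th').
Proof.
move=> thc thc'; have [s [sb sE]] := cyclic_conj thc thc'.
exists (tmx T F s); first exact: tmx_pm1.
split; first exact: tmx_unit.
by rewrite !tmx_mul; congr (tmx T F _); apply/funext => u /=.
Qed.

Lemma pm1_similar_companion_char (F : fieldType) (A : 'M[F]_n) :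
  pm1_similar A (geom_companion F n) -> char_poly A = geom_poly F n.
Proof. by case=> G _ [Gu /(char_poly_similar Gu) ->]; apply: char_poly_companion. Qed.

(** The entries of the product [G *m invmx H] may leave {-1,0,1}, so only plain similarity is
    concluded. *)
Lemma similar_common (F : fieldType) (A B C : 'M[F]_n) :
  pm1_similar A C -> pm1_similar B C -> similar_mx A B.
Proof.
case=> G _ [Gu AG] [H _ [Hu BH]]; exists (G *m invmx H); split.
  by rewrite unitmx_mul Gu unitmx_inv.
rewrite mulmxA AG -!mulmxA; congr (_ *m _).
by rewrite -[LHS](mulKmx Hu) [H *m _]mulmxA -BH mulmxK.
Qed.

End Similarity.

(** * Continuous vertex maps *)

Section VertexPermutation.
Variables (R : realType) (n : nat) (S : topologicalType) (T : ttree R n S).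
Variable f : S -> S.

Definition vperm v := vidx T (f (vertex T v)).

Lemma vertexK v : vidx T (vertex T v) = v.
Proof.
rewrite /vidx; case: xgetP => [w _ /vertex_inj //|/(_ v)].
by case.
Qed.

Lemma oriented_mxE (K : nzRingType) : oriented_mx T K f = tmx T K vperm.
Proof. by apply/matrixP => i j; rewrite !mxE pathc_coef. Qed.

Lemma unoriented_mxE (K : nzRingType) i j :
  unoriented_mx T K f i j = oriented_mx T K f i j ^+ 2.
Proof.
rewrite !mxE; case: (_ \in _) => /=; first by rewrite expr1n.
by case: (_ \in _); rewrite ?expr0n // sqrrN expr1n.
Qed.

Lemma map_unoriented_mx (K L : nzRingType) (h : {rmorphism K -> L}) :
  map_mx h (unoriented_mx T K f) = unoriented_mx T L f.
Proof. by apply/matrixP => i j; rewrite !mxE; case: ifP => _; rewrite ?rmorph1 ?rmorph0. Qed.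

Lemma unoriented_mx_F2 : unoriented_mx T 'F_2 f = oriented_mx T 'F_2 f.
Proof.
apply/matrixP => i j; rewrite unoriented_mxE.
by case: (_ i j) => [[|[|//]] lt]; apply: val_inj.
Qed.

Hypothesis fc : continuous_vertex_map T f.

(** The vertices form a whole orbit, so [f] sends a vertex to a vertex and [vidx] does not return
    its default. *)
Lemma vertex_vperm v : f (vertex T v) = vertex T (vperm v).
Proof.
have [_ _ [x _ orbE] _] := fc; rewrite /vperm /vidx.
case: xgetP => [w _ -> //|no].
have [k _ kv] : [set iter k f x | k in [set: nat]] (vertex T v).
  by rewrite -orbE; exists v.
have [w _ wE] : range (vertex T) (f (vertex T v)).
  by rewrite orbE; exists k.+1 => //=; rewrite kv.
by case: (no w).
Qed.

Lemma vertex_iter k v : iter k f (vertex T v) = vertex T (iter k vperm v).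
Proof. by elim: k => //= k ->; rewrite vertex_vperm. Qed.

Lemma vperm_cyclic : cyclic_map vperm.
Proof.
have [_ _ [x [m m0 mx] orbE] _] := fc.
have [x0 _ x0E] : range (vertex T) x by rewrite orbE; exists 0%N.
apply: (cyclic_of_orbit (x := x0) m0) => [|v].
  by apply: (@vertex_inj _ _ _ T); rewrite -vertex_iter x0E.
have [k _ kv] : [set iter k f x | k in [set: nat]] (vertex T v).
  by rewrite -orbE; exists v.
by exists k; apply: (@vertex_inj _ _ _ T); rewrite -kv -x0E vertex_iter.
Qed.

Lemma sum_iter_Phi (K : nzRingType) (w : 'rV[K]_n) :
  \sum_(0 <= k < n.+1) iter k (Phi T K f) w = 0.
Proof.
rewrite -[RHS](sum_iter_tmx T w vperm_cyclic); apply: eq_bigr => k _.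
by apply: eq_iter => y; rewrite /Phi oriented_mxE.
Qed.

Lemma iter_PhiE (K : nzRingType) k (w : 'rV[K]_n) :
  iter k (Phi T K f) w = iter k (fun y => y *m tmx T K vperm) w.
Proof. by apply: eq_iter => y; rewrite /Phi oriented_mxE. Qed.

Lemma JvecE (K : nzRingType) i j : Jvec T K f i j = pathc T K i (iter j vperm i).
Proof. by rewrite /Jvec vertex_iter vertexK. Qed.

Lemma MfE (K : nzRingType) i j :
  Mf T K f i j = orbit_mx T K vperm i (iter j vperm i).
Proof. by apply/row_matrixP => k; rewrite !rowK iter_PhiE JvecE iter_tmx. Qed.

Lemma Wf_basis (F : fieldType) i j : coprime j n.+1 -> is_basis (Wf T F f i j).
Proof.
move=> jn; have [N NM] := orbit_mx_linv T F i vperm_cyclic jn.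
(* In dimension n, n vectors only have to span, and [w = (w *m N) *m M] is a combination of the rows
   of [M]. *)
rewrite /is_basis basisEdim size_map size_iota dimvf /dim /= mul1n leqnn andbT.
apply/subvP => w _; rewrite -(mulmx1 w) -NM mulmxA -MfE mulmx_sum_row.
apply: memv_suml => k _; apply/memvZ/memv_span; rewrite rowK.
by apply/mapP; exists (k : nat); rewrite // mem_iota /=.
Qed.

(** The constant term is [(-1) ^+ n] times the determinant, which is a unit of [int]. *)
Lemma char_poly_Mf_const i j : coprime j n.+1 ->
  (char_poly (Mf T int f i j))`_0 = 1 \/ (char_poly (Mf T int f i j))`_0 = -1.
Proof.
move=> jn; have := orbit_mx_unit T int i vperm_cyclic jn.
rewrite -MfE unitmxE char_poly_det => Mu.
have : (-1) ^+ n * \det (Mf T int f i j) \is a GRing.unit.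
  by rewrite unitrM unitrX ?unitrN1.
by rewrite /GRing.unit => /= /orP[/eqP|/eqP]; [left | right].
Qed.

End VertexPermutation.

(** * Realization of a tree in a Euclidean space *)

Lemma continuous_bigsum (R : realType) (U : topologicalType) (V : normedModType R)
    (I : Type) (r : seq I) (g : I -> U -> V) :
  (forall i, continuous (g i)) -> continuous (fun x => \sum_(i <- r) g i x).
Proof.
move=> gc; elim: r => [|i r IHr].
  by under eq_fun do rewrite big_nil; move=> x; apply: cvg_cst.
by under eq_fun do rewrite big_cons; move=> x; apply: cvgD; [exact: gc | exact: IHr].
Qed.

Section Realization.
Variables (R : realType) (n : nat) (T : otree n.+1).
Local Notation space := 'rV[R]_n.+1.

Definition pvert v : space := pathc T R ord0 v.
Definition parc i (t : R) : space := pvert (esrc T i) + t *: edge_vec R i.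

Lemma pvert_inj : injective pvert.
Proof. by move=> u v uv; apply/(@pathc_eq0 _ T R); rewrite -(pathcB _ _ ord0) -/(pvert v) -uv subrr. Qed.

Lemma pvertD u v : pvert u + pathc T R u v = pvert v.
Proof. exact: pathcD. Qed.

Lemma parc_src i : parc i 0 = pvert (esrc T i).
Proof. by rewrite /parc scale0r addr0. Qed.

Lemma parc_tgt i : parc i 1 = pvert (etgt T i).
Proof. by rewrite /parc scale1r -(pathc_edge T) pvertD. Qed.

Lemma parc_coef i t j : parc i t 0 j = pvert (esrc T i) 0 j + t * (j == i)%:R.
Proof. by rewrite !mxE eqxx. Qed.

Lemma parc_inj i : injective (parc i).
Proof.
by move=> s t /(congr1 (fun x : space => x 0 i)); rewrite !parc_coef eqxx !mulr1 => /addrI.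
Qed.

Lemma parc_continuous i : continuous (parc i).
Proof.
move=> t; apply: cvgD; first exact: cvg_cst.
exact: scalel_continuous.
Qed.

(** An arc parameter that is also a coordinate of a path vector belongs to an end of the arc; this
    separates the arcs. *)
Lemma unit_pm1 (t : R) : t \in `[0, 1] -> t \in [:: -1; 0; 1] -> t = 0 \/ t = 1.
Proof.
rewrite in_itv /= => /andP[t0 _]; rewrite !inE => /or3P[|/eqP|/eqP]; [|by left|by right].
by move/eqP=> tE; move: t0; rewrite tE; lra.
Qed.

Lemma parc_vertex i t v : t \in `[0, 1] -> parc i t = pvert v -> t = 0 \/ t = 1.
Proof.
move=> t01 /(congr1 (fun x : space => x 0 i)); rewrite parc_coef eqxx mulr1 => tv.
apply: unit_pm1 => //; have := pathc_pm1 T R (esrc T i) v i.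
by rewrite -(pathcB _ _ ord0) !mxE -/(pvert v) -/(pvert _) -tv addrC addKr.
Qed.

(** Coordinate [i] is constant along arc [j], so at a common point [s] is a coordinate of the path
    between the two first vertices. *)
Lemma parc_meet i j s t : i != j -> s \in `[0, 1] -> t \in `[0, 1] ->
  parc i s = parc j t -> exists v, parc i s = pvert v.
Proof.
move=> /negPf ij s01 t01 st.
have := congr1 (fun x : space => x 0 i) st.
rewrite !parc_coef eqxx ij mulr0 addr0 mulr1 => sv.
have := pathc_pm1 T R (esrc T i) (esrc T j) i.
rewrite -(pathcB _ _ ord0) !mxE -/(pvert _) -/(pvert (esrc T i)) -sv addrC addKr.
case/(unit_pm1 s01) => ->; first by exists (esrc T i); rewrite parc_src.
by exists (etgt T i); rewrite parc_tgt.
Qed.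

Definition realization : ttree R n.+1 space :=
  @TTree R n.+1 space T pvert parc (@norm_hausdorff _ _) pvert_inj
    (fun i => continuous_subspaceT (@parc_continuous i))
    (fun i => in2W (@parc_inj i)) parc_src parc_tgt
    parc_vertex parc_meet.

Variable th : 'I_n.+2 -> 'I_n.+2.

Definition clamp (s : R) : R^o := Num.min 1 (Num.max 0 s).

Lemma clamp_le0 s : s <= 0 -> clamp s = 0.
Proof. by move=> s0; rewrite /clamp max_l // min_r. Qed.

Lemma clamp_ge1 s : 1 <= s -> clamp s = 1.
Proof. by move=> s1; rewrite /clamp max_r ?min_l // (le_trans ler01). Qed.

Lemma clamp_id s : 0 <= s <= 1 -> clamp s = s.
Proof. by case/andP=> s0 s1; rewrite /clamp max_r // min_r. Qed.

Lemma clamp_continuous : continuous clamp.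
Proof.
move=> s; apply: (@continuous_min _ _ (cst 1 : R -> R^o) (cst 0 \max id : R -> R^o)).
  exact: cvg_cst.
by apply: (@continuous_max _ _ (cst 0 : R -> R^o)); [exact: cvg_cst | exact: cvg_id].
Qed.

Local Notation dnth p k := (nth (ord0, true) p k).

(** The displacement after length [s] along [p]: dart [k] is run through while [s] grows from k to k
    + 1. Clamping makes it continuous for all real [s], so that the vertex map extends to the whole
    space. *)
Definition travel (p : seq (dart n.+1)) (s : R) : space :=
  \sum_(k < size p) clamp (s - k%:R) *: dart_vec R (dnth p k).

Lemma travel_continuous p : continuous (travel p).
Proof.
apply: continuous_bigsum => k s; apply: cvgZr_tmp.
apply: continuous_cvg; first exact: clamp_continuous.
by apply: cvgB; [exact: cvg_id | exact: cvg_cst].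
Qed.

Lemma travelE p k s : (k < size p)%N -> k%:R <= s <= k.+1%:R ->
  travel p s = path_vec R (take k p) + (s - k%:R) *: dart_vec R (dnth p k).
Proof.
move=> kp /andP[ks sk].
rewrite /travel (bigD1 (Ordinal kp)) //= clamp_id ?subr_ge0 ?ks /=; last first.
  by rewrite lerBlDr addrC -natr1 addrC in sk *.
rewrite addrC; congr (_ + _).
rewrite (eq_bigr (fun l : 'I__ => if (l < k)%N then dart_vec R (dnth p l) else 0)); last first.
  move=> l lk; have [ltlk|] := ltnP l k.
    rewrite clamp_ge1 ?scale1r // lerBrDr (le_trans _ ks) // addrC natr1 ler_nat //.
  rewrite leq_eqVlt => /orP[/eqP kl|ltkl].
    by case/eqP: lk; apply: ord_inj.
  by rewrite clamp_le0 ?scale0r // subr_le0 (le_trans sk) // ler_nat.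
rewrite -big_mkcondr /= /path_vec.
rewrite (eq_bigl (fun l : 'I_(size p) => (l < k)%N)); last first.
  by move=> l /=; case: eqVneq => //= ->; rewrite ltnn.
rewrite -(big_ord_widen _ (fun l => dart_vec R (dnth p l)) (ltnW kp)).
rewrite (big_nth (ord0, true)) size_take kp big_mkord.
by apply: eq_bigr => l _; rewrite nth_take.
Qed.

Lemma travel0 p : travel p 0 = 0.
Proof.
by rewrite /travel big1 // => k _; rewrite clamp_le0 ?scale0r // subr_le0.
Qed.

Lemma travel_end p : travel p (size p)%:R = path_vec R p.
Proof.
rewrite /travel /path_vec (big_nth (ord0, true)) big_mkord; apply: eq_bigr => k _.
by rewrite clamp_ge1 ?scale1r // lerBrDr addrC natr1 ler_nat.
Qed.

Definition epath i := spath T (th (esrc T i)) (th (etgt T i)).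

(* On the arc [i] only the coordinate [i] varies, so the summand [i] moves the
   image along the path [epath i] while the other summands stay constant. *)
Definition rmap (x : space) : space :=
  pvert (th ord0) + \sum_(i < n.+1)
    (travel (epath i) ((size (epath i))%:R * (x 0 i - pvert (esrc T i) 0 i)) -
     travel (epath i) ((size (epath i))%:R * - pvert (esrc T i) 0 i)).

Lemma rmap_continuous : continuous rmap.
Proof.
suff sumc : continuous (fun x : space => \sum_(i < n.+1)
    (travel (epath i) ((size (epath i))%:R * (x 0 i - pvert (esrc T i) 0 i)) -
     travel (epath i) ((size (epath i))%:R * - pvert (esrc T i) 0 i))).
  by move=> x; apply: cvgD (cvg_cst (pvert (th ord0))) (sumc x).
apply: continuous_bigsum => i x.
apply: (@cvgB _ _ _ (nbhs x)); last exact: cvg_cst.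
apply: (@continuous_cvg _ _ _ (nbhs x)); first exact: travel_continuous.
apply: (@cvgM _ _ (nbhs x)); first exact: cvg_cst.
by apply: (@cvgB _ _ _ (nbhs x)); [exact: coord_continuous | exact: cvg_cst].
Qed.

Lemma rmap_arc_src i t : rmap (parc i t) =
  rmap (pvert (esrc T i)) + travel (epath i) ((size (epath i))%:R * t).
Proof.
rewrite /rmap (bigD1 i) //= [in RHS](bigD1 i) //=.
rewrite (eq_bigr (fun j => travel (epath j) ((size (epath j))%:R *
    (pvert (esrc T i) 0 j - pvert (esrc T j) 0 j)) -
  travel (epath j) ((size (epath j))%:R * - pvert (esrc T j) 0 j))); last first.
  by move=> j /negPf ji; rewrite parc_coef ji mulr0 addr0.
rewrite parc_coef eqxx mulr1 [_ + t]addrC addrK subrr mulr0 travel0 sub0r.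
by rewrite -!addrA; congr (_ + _); rewrite [in RHS]addrC addrA addrC -!addrA addrC.
Qed.

(** At the origin, the place of [ord0], the subtracted terms cancel every summand; along an edge
    both sides change by the vector of the image path. Connectedness does the rest. *)
Lemma rmap_vertex v : rmap (pvert v) = pvert (th v).
Proof.
have r0 : pvert ord0 = 0 by apply: pathcc.
have R0 : rmap (pvert ord0) = pvert (th ord0).
  rewrite /rmap r0 big1 ?addr0 // => i _.
  by rewrite mxE sub0r subrr.
apply/eqP; rewrite -subr_eq0; apply/eqP.
rewrite (@edge_constant _ T _ (fun v => rmap (pvert v) - pvert (th v)) _ v ord0).
  by rewrite R0 subrr.
move=> i; rewrite -parc_tgt rmap_arc_src mulr1 travel_end.
have -> : path_vec R (epath i) = pvert (th (etgt T i)) - pvert (th (esrc T i)).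
  by rewrite pathcB.
by rewrite -[RHS]addrA [_ - _ - _]addrAC subrr sub0r.
Qed.

Lemma dart_pointE e s : dart_point realization e s =
  pvert (dart_src (esrc T) (etgt T) e) + s *: dart_vec R e.
Proof.
rewrite /dart_point /dart_src /dart_vec /= /parc; case: e.2 => //.
by rewrite -(pvertD (esrc T e.1) (etgt T e.1)) pathc_edge scalerBl scale1r scalerN addrA.
Qed.

Lemma take_walk_vec u p v k : walk T u p v -> (k < size p)%N ->
  pvert u + path_vec R (take k p) = pvert (dart_src (esrc T) (etgt T) (dnth p k)).
Proof.
elim: p u k => // e p IHp u [|k] /andP[/eqP <- pw] kp.
  by rewrite take0 path_vec_nil addr0.
rewrite /= path_vec_cons -(IHp (dart_tgt (esrc T) (etgt T) e) k) //.
by rewrite addrA -(pathc_dart T) pvertD.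
Qed.

Lemma rmap_arc i t k : (k < size (epath i))%N ->
  k%:R <= (size (epath i))%:R * t <= k.+1%:R ->
  rmap (parc i t) = dart_point realization (nth (i, true) (epath i) k)
    ((size (epath i))%:R * t - k%:R).
Proof.
move=> kp kt; rewrite rmap_arc_src (travelE kp) // rmap_vertex addrA.
rewrite (take_walk_vec (spath_walk T _ _)) // dart_pointE.
by rewrite (set_nth_default (ord0, true)).
Qed.

Lemma unit_cell (m : nat) (s : R) : (0 < m)%N -> 0 <= s <= m%:R ->
  exists2 k, (k < m)%N & k%:R <= s <= k.+1%:R.
Proof.
elim: m => // -[_ _ sm|m IHm _ /andP[s0 sm]]; first by exists 0%N.
have [ms|ms] := leP m.+1%:R s; first by exists m.+1; rewrite ?ms.
by case: IHm => // [|k km ks]; [rewrite s0 ltW | exists k => //; apply: ltnW].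
Qed.

Hypothesis thc : cyclic_map th.

(** The ends of an edge differ because its vector is nonzero, and [th] is injective. *)
Lemma epath_gt0 i : (0 < size (epath i))%N.
Proof.
rewrite lt0n size_eq0; apply/eqP => p0.
have := spath_walk T (th (esrc T i)) (th (etgt T i)).
rewrite -/(epath i) p0 /walk /= => /eqP/(thc.1) st.
have := pathc_edge T R i; rewrite st pathcc => /rowP/(_ i)/eqP.
by rewrite !mxE !eqxx eq_sym oner_eq0.
Qed.

Lemma rmap_vperm v : vperm realization rmap v = th v.
Proof. by rewrite /vperm rmap_vertex (vertexK realization). Qed.

Lemma rmap_vertex_map : continuous_vertex_map realization rmap.
Proof.
split.
- move=> _ [_ [i _ [t t01 <-]] <-].
  move: (t01); rewrite /= in_itv /= => /andP[t0 t1].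
  have m0 : 0 <= (size (epath i))%:R :> R by [].
  have [|k kp kt] := unit_cell (epath_gt0 i) (s := (size (epath i))%:R * t).
    by rewrite mulr_ge0 //= ler_piMr.
  rewrite (rmap_arc kp kt) /dart_point; set e := nth _ _ _.
  have u01 : 0 <= (size (epath i))%:R * t - k%:R <= 1.
    by move: kt; rewrite -natr1; lra.
  exists e.1 => //; case: e.2.
    by exists ((size (epath i))%:R * t - k%:R); rewrite //= in_itv.
  by exists (1 - ((size (epath i))%:R * t - k%:R)); rewrite //= in_itv /=; lra.
- exact/continuous_subspaceT/rmap_continuous.
- have itE k v : iter k rmap (pvert v) = pvert (iter k th v).
    by elim: k => //= k ->; rewrite rmap_vertex.
  (* With [n.+1] edges there are [n.+2] vertices, which is the period. *)
  exists (pvert ord0); first by exists n.+2; rewrite // itE cyclic_iter_order.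
  apply/seteqP; split=> [_ [v _ <-]|_ [k _ <-]].
    have [_ /(_ ord0 v)/iter_findex <-] := thc.
    by exists (findex th ord0 v); rewrite // itE.
  by exists (iter k th ord0); rewrite // itE.
move=> i; have pE : image_path realization rmap i = epath i.
  by rewrite /image_path /epath -!rmap_vperm.
(* The image path is run through at constant speed. *)
rewrite /monotone_on_edge pE; exists (fun t => (size (epath i))%:R * t); split.
- by move=> s t _ _ st; rewrite ler_wpM2l.
- by rewrite mulr0.
- by rewrite mulr1.
- by move=> t k _ kp kt; apply: rmap_arc.
Qed.

End Realization.

(** * Examples *)

(* [h i] is constant along every edge except [E_i], where it increases by 1:
   it separates the two sides of [E_i], whence there is no cycle, and measures
   the [i]-th coordinate of paths. *)
Definition edge_potential n (src tgt : 'I_n -> 'I_n.+1) (h : 'I_n -> 'I_n.+1 -> int) :=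
  forall i j, h i (tgt j) - h i (src j) = (i == j)%:R.

Section Potential.
Variables (n : nat) (src tgt : 'I_n -> 'I_n.+1) (h : 'I_n -> 'I_n.+1 -> int).
Hypothesis hP : edge_potential src tgt h.

Lemma potential_walk u p v i :
  is_walk src tgt u p v -> path_vec int p 0 i = h i v - h i u.
Proof.
elim: p u => [|e p IHp] u /=; first by move/eqP->; rewrite path_vec_nil mxE subrr.
case/andP=> /eqP <- /IHp pE; rewrite path_vec_cons mxE pE.
suff -> : dart_vec int e 0 i = h i (dart_tgt src tgt e) - h i (dart_src src tgt e).
  by rewrite addrC addrA subrK.
by rewrite /dart_vec /dart_src /dart_tgt; case: e.2; rewrite !mxE -hP ?opprB.
Qed.

(** In a nonempty walk over distinct edges the first edge has coefficient 1 or -1, whereas its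
    potential is the same at both ends of a closed walk. *)
Lemma potential_acyclic u p :
  is_walk src tgt u p u -> uniq [seq e.1 | e <- p] -> p = [::].
Proof.
case: p => // -[i b] p pw pu; have := potential_walk i pw.
rewrite subrr path_vec_coef // !inE !xpair_eqE !eqxx /=.
by case: b {pw pu} => //=; case: (_ \in _).
Qed.

Lemma connected_from_root :
  (forall v, exists p, is_walk src tgt ord0 p v) ->
  forall u v, exists p, is_walk src tgt u p v.
Proof.
move=> root u v; suff [q uq] : exists q, is_walk src tgt u q ord0.
  by have [p vp] := root v; exists (q ++ p); apply/walk_catP; exists ord0.
have [p] := root u; move: ord0 => w.
elim: p w => [|[i b] p IHp] w /=; first by move/eqP->; exists [::] => /=.
case/andP=> /eqP <- /IHp[q qw]; exists (q ++ [:: (i, ~~ b)]).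
apply/walk_catP; exists (dart_tgt src tgt (i, b)) => //=.
by rewrite /dart_src /dart_tgt /=; case: b {qw}; rewrite /= !eqxx.
Qed.

End Potential.

Section PotentialCoefficients.
Variables (n : nat) (T : otree n) (h : 'I_n -> 'I_n.+1 -> int).
Hypothesis hP : edge_potential (esrc T) (etgt T) h.

(** [spath] is obtained by choice and does not compute; potentials turn coefficients over any ring
    into integers that do. *)
Lemma pathc_potential (K : nzRingType) u v i :
  pathc T K u v 0 i = (h i v - h i u)%:~R.
Proof.
apply/eqP; rewrite rmorphB /= -subr_eq0; apply/eqP.
rewrite (@edge_constant _ T _
  (fun v => pathc T K u v 0 i - ((h i v)%:~R - (h i u)%:~R)) _ v u).
  by rewrite pathcc mxE !subrr.
move=> j; rewrite -(pathcD _ _ u (esrc T j) (etgt T j)) pathc_edge !mxE eqxx /=.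
have -> : h i (etgt T j) = h i (esrc T j) + (i == j)%:R.
  by rewrite -(hP i j) addrC subrK.
rewrite rmorphD /= (_ : (i == j)%:R%:~R = (i == j)%:R :> K); last by case: eqP.
have shift (a b c d : K) : a - (b - c) = a + d - (b + d - c).
  by rewrite [b + d]addrC -(addrA d b) [in RHS]opprD [RHS]addrA addrK.
exact: shift.
Qed.

Lemma tmx_potential (K : nzRingType) th i j :
  tmx T K th i j = (h j (th (etgt T i)) - h j (th (esrc T i)))%:~R.
Proof. by rewrite mxE pathc_potential. Qed.

End PotentialCoefficients.

Section Examples.

Local Notation ord k n := (@Ordinal n k isT).

Definition six_src (i : 'I_5) : 'I_6 :=
  nth ord0 [:: ord 0 6; ord 2 6; ord 1 6; ord 4 6; ord 4 6] i.
Definition six_tgt (i : 'I_5) : 'I_6 :=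
  nth ord0 [:: ord 1 6; ord 1 6; ord 4 6; ord 5 6; ord 3 6] i.
(** Row [i] lists the coordinate along E_i of the paths from vertex 1; the entry -1 arises because
    [3,2] points towards vertex 1. *)
Definition six_pot (i : 'I_5) (v : 'I_6) : int :=
  (nth [::] [:: [:: 0; 1;  1; 1; 1; 1];
                [:: 0; 0; -1; 0; 0; 0];
                [:: 0; 0;  0; 1; 1; 1];
                [:: 0; 0;  0; 0; 0; 1];
                [:: 0; 0;  0; 1; 0; 0]] i)`_v.

Lemma six_potP : edge_potential six_src six_tgt six_pot.
Proof. by do 2![case=> [[|[|[|[|[|//]]]]] ?]]. Qed.

Lemma six_connected u v : exists p, is_walk six_src six_tgt u p v.
Proof.
apply: connected_from_root => {u v} -[[|[|[|[|[|[|//]]]]]] ?].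
- by exists [::].
- by exists [:: (ord 0 5, true)].
- by exists [:: (ord 0 5, true); (ord 1 5, false)].
- by exists [:: (ord 0 5, true); (ord 2 5, true); (ord 4 5, true)].
- by exists [:: (ord 0 5, true); (ord 2 5, true)].
- by exists [:: (ord 0 5, true); (ord 2 5, true); (ord 3 5, true)].
Qed.

Definition six_otree : otree 5 := OTree six_connected (potential_acyclic six_potP).

Lemma six_otreeP : six_tree six_otree.
Proof.
split=> /=.
  rewrite (map_comp (fun k => nat_of_ord (nth ord0 [:: _; _; _; _; _] k)) val).
  by rewrite val_enum_ord.
rewrite (map_comp (fun k => nat_of_ord (nth ord0 [:: _; _; _; _; _] k)) val).
by rewrite val_enum_ord.
Qed.

Lemma ordS_cyclic n : cyclic_map (@ordS n.+1).
Proof.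
have itE k : iter k (@ordS n.+1) ord0 = (k %% n.+1)%N :> nat.
  by elim: k => [|k IHk] /=; rewrite ?mod0n // IHk -[_.+1]addn1 modnDml addn1.
apply: (@cyclic_of_orbit _ _ ord0 n.+1) => // [|v].
  by apply: ord_inj; rewrite itE modnn.
by exists v; apply: ord_inj; rewrite itE modn_small.
Qed.

Lemma six_oriented_mx (F : fieldType) :
  tmx six_otree F (@ordS 6) = map_mx intr six_mx.
Proof.
apply/matrixP => i j; rewrite (tmx_potential six_potP) !mxE; congr (_%:~R).
by move: i j; do 2![case=> [[|[|[|[|[|//]]]]] ?]].
Qed.

(** The rows are the paths [1,2], [2,3], ..., [5,6]. *)
Definition six_orbit_mx : 'M[int]_5 :=
  \matrix_(i < 5, j < 5)
    (nth [::] [:: [:: 1;  0; 0; 0;  0];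
                  [:: 0; -1; 0; 0;  0];
                  [:: 0;  1; 1; 0;  1];
                  [:: 0;  0; 0; 0; -1];
                  [:: 0;  0; 0; 1;  0]] i)`_j.

Lemma six_orbit_mxE : orbit_mx six_otree int (@ordS 6) ord0 (ordS ord0) = six_orbit_mx.
Proof.
apply/matrixP => i j; rewrite !mxE (pathc_potential six_potP) intz.
by move: i j; do 2![case=> [[|[|[|[|[|//]]]]] ?]].
Qed.

Lemma det_first_row (K : comNzRingType) m (A : 'M[K]_m.+1) :
  (forall j, A ord0 (lift ord0 j) = 0) ->
  \det A = A ord0 ord0 * \det (row' ord0 (col' ord0 A)).
Proof.
move=> A0; rewrite (expand_det_row _ ord0) big_ord_recl big1 => [|j _].
  by rewrite addr0 /cofactor addn0 expr0 mul1r.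
by rewrite A0 mul0r.
Qed.

(** Three expansions split off x - 1, x + 1 and x - 1, leaving x^2 + 1. *)
Lemma char_poly_six_orbit_mx : char_poly six_orbit_mx = 'X^5 - 'X^4 - 'X + 1.
Proof.
rewrite /char_poly det_first_row; last first.
  by case=> [[|[|[|[|//]]]] ?]; rewrite !mxE /= subr0.
rewrite det_first_row; last first.
  by case=> [[|[|[|//]]] ?]; rewrite !mxE /= subr0.
(* In the remaining block it is the first column that vanishes off the diagonal. *)
rewrite -det_tr det_first_row; last first.
  by case=> [[|[|//]] ?]; rewrite !mxE /= subr0.
rewrite (expand_det_row _ ord0) !big_ord_recl big_ord0 /cofactor !det_mx11.
by rewrite !mxE /= !(polyC0, polyCN, polyC1, mulr1n, mulr0n); ring.
Qed.

Lemma six_realization (R : realType) :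
  exists (S : topologicalType) (T : ttree R 5 S) (f : S -> S),
     [/\ six_tree T, six_map T f,
         forall F : fieldType, oriented_mx T F f = map_mx intr six_mx,
         char_poly (Mf T int f ord0 1) = 'X^5 - 'X^4 - 'X + 1 &
         ~ (forall k, (k <= 5)%N ->
              odd_int (char_poly (Mf T int f ord0 1))`_k)].
Proof.
pose f := @rmap R 4 six_otree (@ordS 6).
have fc := rmap_vertex_map R six_otree (ordS_cyclic 5).
have fE : vperm (realization R six_otree) f = @ordS 6.
  by apply/funext => v; apply: rmap_vperm.
have charE : char_poly (Mf (realization R six_otree) int f ord0 1) =
    'X^5 - 'X^4 - 'X + 1.
  by rewrite MfE // fE /= six_orbit_mxE char_poly_six_orbit_mx.
exists _, (realization R six_otree), f; split=> //.
- exact: six_otreeP.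
- by split=> // v; apply: rmap_vertex.
- by move=> F; rewrite oriented_mxE fE six_oriented_mx.
(* The coefficient of x^2 is 0, hence even. *)
rewrite charE => /(_ 2 isT).
by rewrite !coefD !coefN !coefXn coefX coef1.
Qed.

Definition line_src (i : 'I_3) : 'I_4 := nth ord0 [:: ord 0 4; ord 1 4; ord 2 4] i.
Definition line_tgt (i : 'I_3) : 'I_4 := nth ord0 [:: ord 1 4; ord 2 4; ord 3 4] i.
Definition line_pot (i : 'I_3) (v : 'I_4) : int := (i < v)%N%:R.

Lemma line_potP : edge_potential line_src line_tgt line_pot.
Proof. by do 2![case=> [[|[|[|//]]] ?]]. Qed.

Lemma line_connected u v : exists p, is_walk line_src line_tgt u p v.
Proof.
apply: connected_from_root => {u v} -[[|[|[|[|//]]]] ?].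
- by exists [::].
- by exists [:: (ord 0 3, true)].
- by exists [:: (ord 0 3, true); (ord 1 3, true)].
- by exists [:: (ord 0 3, true); (ord 1 3, true); (ord 2 3, true)].
Qed.

Definition line_otree : otree 3 := OTree line_connected (potential_acyclic line_potP).

(** The cycle 1 -> 3 -> 4 -> 2 -> 1 makes the image of every edge cover that edge; under [ordS] only
    the last edge has this property. *)
Definition line_map (v : 'I_4) : 'I_4 :=
  nth ord0 [:: ord 2 4; ord 0 4; ord 3 4; ord 1 4] v.

Lemma line_map_cyclic : cyclic_map line_map.
Proof.
apply: (@cyclic_of_orbit _ _ ord0 4) => // [|[[|[|[|[|//]]]] ?]].
- exact: ord_inj.
- by exists 0; apply: ord_inj.
- by exists 3; apply: ord_inj.
- by exists 1; apply: ord_inj.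
- by exists 2; apply: ord_inj.
Qed.

Lemma mxtrace_similar (F : fieldType) n (A B : 'M[F]_n) :
  similar_mx A B -> \tr A = \tr B.
Proof.
case=> G [Gu AG]; rewrite -[A](mulmxK Gu) AG -mulmxA.
by rewrite mxtrace_mulC -mulmxA mulVmx // mulmx1.
Qed.

(* The two unoriented matrices have traces 1 and 3. *)
Lemma unoriented_not_similar (R : realType) (F : fieldType) : 2 != 0 :> F ->
  exists (S : topologicalType) (T : ttree R 3 S) (f g : S -> S),
    [/\ continuous_vertex_map T f, continuous_vertex_map T g &
      ~ similar_mx (unoriented_mx T F f) (unoriented_mx T F g)].
Proof.
move=> F2; pose T := realization R line_otree.
exists _, T, (rmap (R := R) line_otree (@ordS 4)), (rmap (R := R) line_otree line_map).
split; [exact/rmap_vertex_map/ordS_cyclic | exact/rmap_vertex_map/line_map_cyclic |].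
move/mxtrace_similar/eqP; apply/negP; rewrite eq_sym.
(* The diagonal entries are squares of integers independent of the field, so the traces can be
   evaluated over [int]. *)
have trE th : cyclic_map th -> \tr (unoriented_mx T F (rmap (R := R) line_otree th)) =
    (\sum_i (line_pot i (th (line_tgt i)) - line_pot i (th (line_src i))) ^+ 2)%:~R.
  move=> thc; rewrite rmorph_sum; apply: eq_bigr => i _.
  rewrite unoriented_mxE oriented_mxE rmorphXn (tmx_potential line_potP).
  by rewrite !rmap_vperm.
rewrite (trE _ (ordS_cyclic 3)) (trE _ line_map_cyclic).
by rewrite !big_ord_recl !big_ord0 -subr_eq0 -rmorphB (_ : _ - _ = 2 :> int).
Qed.

End Examples.

(** The inverse matrix belongs to the inverse vertex permutation, which is again cyclic, so results
    on [tmx] cover both matrices. *)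
Lemma oriented_mx_class (R : realType) n (S : topologicalType) (T : ttree R n S)
    (F : fieldType) (f : S -> S) (A : 'M[F]_n) : continuous_vertex_map T f ->
  A = oriented_mx T F f \/ A = invmx (oriented_mx T F f) ->
  exists2 th, cyclic_map th & A = tmx T F th.
Proof.
move=> /vperm_cyclic thc; have [th' [thc' thK th'K]] := cyclic_inv thc.
rewrite oriented_mxE (invmx_tmx _ _ thK th'K).
by case=> ->; [exists (vperm T f) | exists th'].
Qed.

(** Modulo 2 the matrix becomes the oriented one, whose characteristic polynomial has all
    coefficients 1. *)
Lemma odd_char_poly_unoriented (R : realType) n (S : topologicalType) (T : ttree R n S)
    (f : S -> S) k : continuous_vertex_map T f -> (k <= n)%N ->
  odd_int (char_poly (unoriented_mx T int f))`_k.
Proof.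
move=> fc kn; set p := char_poly _; have : (p`_k)%:~R = 1 :> 'F_2.
  rewrite -(coef_map (intr : {rmorphism int -> 'F_2})) map_char_poly map_unoriented_mx.
  rewrite unoriented_mx_F2 oriented_mxE.
  rewrite (pm1_similar_companion_char (tmx_companion _ _ (vperm_cyclic fc))).
  exact: coef_geom_poly.
rewrite /odd_int; case: (boolP (2 %| p`_k)%Z) => // /dvdzP[q ->].
by rewrite rmorphM /= (_ : 2%:~R = 0 :> 'F_2) ?mulr0 //; apply: val_inj.
Qed.

Theorem theorem1 (R : realType) :
  (* (1) *)
  (forall (n : nat) (S : topologicalType) (T : ttree R n S) (f : S -> S)
      (F : fieldType),
    (2 <= n)%N -> continuous_vertex_map T f ->
    (forall i : 'I_n,
       \sum_(0 <= k < n.+1) iter k (Phi T F f) (edge_vec F i) = 0) /\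
    (forall w : 'rV[F]_n, \sum_(0 <= k < n.+1) iter k (Phi T F f) w = 0)) /\
  (* (2) *)
  ((forall (n : nat) (S : topologicalType) (T : ttree R n S) (f : S -> S)
      (i : 'I_n.+1) (j : nat),
     (2 <= n)%N -> continuous_vertex_map T f ->
     (i < n)%N -> (1 <= j <= n)%N -> coprime j n.+1 ->
     is_basis (Wf T 'F_2 f i j) /\
     (forall F : fieldType,
        char_zero F \/
        (exists2 p : nat, p \in [pchar F]
                        & ~~ (p %| \det (Mf T int f i j))%Z) ->
        is_basis (Wf T F f i j))) /\
   (forall (n : nat) (T : ttree R n R) (f : R -> R) (i : 'I_n.+1) (j : nat),
     (2 <= n)%N -> in_real_line T -> continuous_vertex_map T f ->
     (i < n)%N -> (1 <= j <= n)%N -> coprime j n.+1 ->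
     ((char_poly (Mf T int f i j))`_0 = 1 \/
      (char_poly (Mf T int f i j))`_0 = -1) /\
     (forall F : fieldType, is_basis (Wf T F f i j))) /\
   (exists (S : topologicalType) (T : ttree R 5 S) (f : S -> S),
     [/\ six_tree T, six_map T f,
         forall F : fieldType, oriented_mx T F f = map_mx intr six_mx,
         char_poly (Mf T int f ord0 1) = 'X^5 - 'X^4 - 'X + 1 &
         ~ (forall k, (k <= 5)%N ->
              odd_int (char_poly (Mf T int f ord0 1))`_k)])) /\
  (* (3) *)
  ((forall (n : nat) (S : topologicalType) (T : ttree R n S) (f : S -> S),
     (2 <= n)%N -> continuous_vertex_map T f ->
     let claim (F : fieldType) :=
       let A := oriented_mx T F f in
       [/\ A \in unitmx, pm1_mx A /\ pm1_mx (invmx A),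
           pm1_similar A (geom_companion F n),
           pm1_similar (invmx A) (geom_companion F n) &
           char_poly A = geom_poly F n /\ char_poly (invmx A) = geom_poly F n] in
     (forall F : fieldType, char_zero F -> claim F) /\ claim 'F_2) /\
   (forall F : fieldType, char_zero F ->
     exists (n : nat) (S : topologicalType) (T : ttree R n S) (f g : S -> S),
       [/\ (2 <= n)%N, continuous_vertex_map T f, continuous_vertex_map T g &
           ~ similar_mx (unoriented_mx T F f) (unoriented_mx T F g)]) /\
   (forall (n : nat) (T : ttree R n R) (F : fieldType),
     (2 <= n)%N -> in_real_line T ->
     let in_class (A : 'M[F]_n) :=
       exists2 f : R -> R, continuous_vertex_map T f &
         A = oriented_mx T F f \/ A = invmx (oriented_mx T F f) in
     (forall f : R -> R, continuous_vertex_map T f ->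
        oriented_mx T F f \in unitmx) /\
     (forall A B : 'M[F]_n, in_class A -> in_class B -> pm1_similar A B) /\
     (forall A : 'M[F]_n, in_class A -> char_poly A = geom_poly F n))) /\
  (* (4) *)
  ((forall (n : nat) (S : topologicalType) (T : ttree R n S) (f : S -> S),
     (2 <= n)%N -> continuous_vertex_map T f ->
     forall k, (k <= n)%N ->
       exists2 z : int, odd_int z &
         (char_poly (unoriented_mx T R f))`_k = z%:~R) /\
   (forall (n : nat) (S1 S2 : topologicalType)
      (T1 : ttree R n S1) (T2 : ttree R n S2) (f1 : S1 -> S1) (f2 : S2 -> S2),
     (2 <= n)%N -> continuous_vertex_map T1 f1 -> continuous_vertex_map T2 f2 ->
     similar_mx (unoriented_mx T1 'F_2 f1) (unoriented_mx T2 'F_2 f2)) /\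
   (forall (n : nat) (S : topologicalType) (T : ttree R n S) (f : S -> S),
     (2 <= n)%N -> continuous_vertex_map T f ->
     char_poly (unoriented_mx T 'F_2 f) = geom_poly 'F_2 n) /\
   (forall p : nat, prime p -> (3 <= p)%N ->
     exists (n : nat) (S1 S2 : topologicalType)
       (T1 : ttree R n S1) (T2 : ttree R n S2) (f1 : S1 -> S1) (f2 : S2 -> S2),
       [/\ (2 <= n)%N, continuous_vertex_map T1 f1, continuous_vertex_map T2 f2 &
           ~ similar_mx (unoriented_mx T1 'F_p f1) (unoriented_mx T2 'F_p f2)])).
Proof.
split; first by move=> n S T f F _ fc; split=> *; apply: sum_iter_Phi.
split; [split; [|split] | split; [split; [|split] | split; [|split; [|split]]]].
- move=> n S T f i j _ fc _ _ jn.
  by split=> [|F _]; apply: Wf_basis.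
- move=> n T f i j _ _ fc _ _ jn.
  by split=> [|F]; [apply: char_poly_Mf_const | apply: Wf_basis].
- exact: six_realization.
- move=> n S T f _ fc claim; suff allF F : claim F by [].
  have [th thc thE] := oriented_mx_class fc (or_introl (erefl (oriented_mx T F f))).
  have [th' thc' th'E] := oriented_mx_class fc (or_intror (erefl (invmx (oriented_mx T F f)))).
  rewrite /claim th'E thE; split.
  + by apply: tmx_unit; apply: injF_bij; case: thc.
  + by split; apply: tmx_pm1.
  + exact: tmx_companion.
  + exact: tmx_companion.
  + by split; apply/pm1_similar_companion_char/tmx_companion.
- move=> F F0; have F2 : 2 != 0 :> F.
    by have := F0 2; rewrite !inE /= => /negbT.
  have [S [T [f [g [fc gc nsim]]]]] := unoriented_not_similar R F2.
  by exists 3, S, T, f, g.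
- move=> n T F _ _ in_class; split; [|split].
  + move=> f fc; rewrite oriented_mxE; apply: tmx_unit; apply: injF_bij.
    by case: (vperm_cyclic fc).
  + move=> A B [f fc fA] [g gc gB].
    have [th thc ->] := oriented_mx_class fc fA.
    have [th' thc' ->] := oriented_mx_class gc gB.
    exact: tmx_pm1_similar.
  + move=> A [f fc fA]; have [th thc ->] := oriented_mx_class fc fA.
    exact/pm1_similar_companion_char/tmx_companion.
- move=> n S T f _ fc k kn; exists (char_poly (unoriented_mx T int f))`_k.
    exact: odd_char_poly_unoriented.
  rewrite -(coef_map (intr : {rmorphism int -> R})) map_char_poly.
  by rewrite map_unoriented_mx.
(* The two trees may differ, but the companion matrix depends on [n] only and links both
   matrices. *)
- move=> n S1 S2 T1 T2 f1 f2 _ fc1 fc2; rewrite !unoriented_mx_F2 !oriented_mxE.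
  by apply: similar_common; apply/tmx_companion/vperm_cyclic.
- move=> n S T f _ fc; rewrite unoriented_mx_F2 oriented_mxE.
  exact/pm1_similar_companion_char/tmx_companion/vperm_cyclic.
move=> p pp p3; have F2 : 2 != 0 :> 'F_p.
  rewrite -(dvdn_pcharf (pchar_Fp pp)) gtnNdvd //.
have [S [T [f [g [fc gc nsim]]]]] := unoriented_not_similar R F2.
by exists 3, S, S, T, T, f, g.
Qed.
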